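(* Let $\lambda$ be a self-conjugate partition. There is a bijection between $\lambda$-plane trees on $k+1$ vertices and $\lambda$-Dyck paths of length $2k$.
   Context: A partition is a weakly decreasing sequence $\lambda=(\lambda_1\ge\lambda_2\ge\cdots)$ of nonnegative integers, eventually zero; its length $\ell(\lambda)$ is the number of positive parts. It is identified with its Young diagram $\{(i,j)\in\mathbb{Z}^2:1\le i\le\ell(\lambda),\ 1\le j\le\lambda_i\}$, and it is self-conjugate if this set is invariant under $(i,j)\mapsto(j,i)$. A plane tree is a rooted tree in which the children of every vertex are linearly ordered. For $\lambda$ self-conjugate of length $\ell$, a $\lambda$-plane tree is a pair $(T,c)$, where $T$ is a plane tree with vertex set $V$ and edge set $E$ and $c:V\to\{1,\dots,\ell\}$ is a labelling satisfying $(c(u),c(v))\in\lambda$ whenever $\{u,v\}\in E$. They are considered up to isomorphism preserving root, order of children, and labels. A Dyck path of length $2k$ is an integer sequence $(h_t)_{t=0}^{2k}$ with $h_0=h_{2k}=0$, $h_t-h_{t-1}=\pm1$ for all $1\le t\le 2k$, and $h_t\ge0$ for all $1\le t\le 2k-1$. A $\lambda$-path of length $M\ge0$ is a sequence $\pi=(i_t,j_t,h_t)_{t=0}^M$ in $\mathbb{Z}^3$ such that: (i) $(i_t,j_t)\in\lambda$ for all $t\in\{0,\dots,M\}$; (ii) $i_t-i_{t-1}=0$ for all odd $t\in\{1,\dots,M\}$; (iii) $j_t-j_{t-1}=0$ for all even $t\in\{1,\dots,M\}$; (iv) $h_t-h_{t-1}=\pm1$ for all $t\in\{1,\dots,M\}$.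 The sequence $(h_t)_{t=0}^M$ is called the height of the path. A height excursion of a $\lambda$-path $(i_t,j_t,h_t)_{t=0}^M$ is a subpath $(i_t,j_t,h_t)_{t=a}^b$, with $0\le a<b\le M$, such that $h_a=h_b<h_t$ for all $a<t<b$. It is balanced if $(i_{a+1},j_{a+1})=(i_b,j_b)$, and unbalanced otherwise. A $\lambda$-Dyck path of length $2k$ is a $\lambda$-path $\pi=(i_t,j_t,h_t)_{t=0}^{2k}$ such that: (i) the height $(h_t)_{t=0}^{2k}$ of $\pi$ is a Dyck path; (ii) $(i_0,j_0)=(i_{2k},j_{2k})$; (iii) $\pi$ contains no unbalanced height excursions.
   Formalization: The bijection is claimed for k ≥ 1 only; for k = 0 it fails in general, e.g. for λ = (2,1) there are 2 one-vertex λ-plane trees but 3 λ-Dyck paths of length 0. *)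

(* Defs.v *)
From mathcomp Require Import all_boot all_order all_algebra.
From mathcomp Require Import classical_sets functions.
Set Implicit Arguments.
Unset Strict Implicit.
Unset Printing Implicit Defensive.
Import Order.TTheory GRing.Theory Num.Theory.

Local Open Scope nat_scope.

(* A finite sequence stands for its extension by zeros; trailing zeros are
   allowed. Parts are numbered from 1. *)
Definition is_partition (la : seq nat) : bool := sorted geq la.

Definition part (la : seq nat) (i : nat) : nat := nth 0 la i.-1.

Definition plength (la : seq nat) : nat := count (fun p => 0 < p) la.

(* The Young diagram consists of pairs of positive integers, so natural
   coordinates suffice. *)
Definition young (la : seq nat) (x : nat * nat) : bool :=
  (1 <= x.1 <= plength la) && (1 <= x.2 <= part la x.1).

Definition self_conjugate (la : seq nat) : Prop :=
  forall i j : nat, young la (i, j) = young la (j, i).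

(* Each term is exactly one isomorphism class of plane trees with vertices
   labelled by natural numbers: a root label and the ordered list of the
   subtrees at the children of the root. *)
Inductive labelled_plane_tree : Type :=
  Node of nat & seq labelled_plane_tree.

Definition root_label (T : labelled_plane_tree) : nat :=
  let: Node c _ := T in c.

(* One entry per vertex: its label. *)
Fixpoint vertex_labels (T : labelled_plane_tree) : seq nat :=
  let: Node c Ts := T in c :: flatten (map vertex_labels Ts).

(* One entry per edge: the labels of its parent and child endpoints. *)
Fixpoint edge_labels (T : labelled_plane_tree) : seq (nat * nat) :=
  let: Node c Ts := T in
  flatten (map (fun U => (c, root_label U) :: edge_labels U) Ts).

Definition num_vertices (T : labelled_plane_tree) : nat :=
  size (vertex_labels T).

(* Edges are unordered, so both orders of the endpoints are constrained. *)
Definition is_lambda_plane_tree (la : seq nat) (T : labelled_plane_tree) :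
    bool :=
  all (fun c => 1 <= c <= plength la) (vertex_labels T) &&
  all (fun e => young la (e.1, e.2) && young la (e.2, e.1)) (edge_labels T).

Definition lambda_plane_trees (la : seq nat) (n : nat) :
    set labelled_plane_tree :=
  [set T | is_lambda_plane_tree la T /\ num_vertices T = n]%classic.

(* The points (i_t, j_t, h_t) for t = 0, ..., M. *)
Definition path3 (M : nat) : Type := M.+1.-tuple (nat * nat * int).

Section Paths.
Variables (M : nat) (pi : path3 M).

(* The default value is never reached for t <= M. *)
Definition point (t : nat) : nat * nat * int := nth (0, 0, 0%R) pi t.
Definition pos (t : nat) : nat * nat := (point t).1.
Definition row (t : nat) : nat := (pos t).1.
Definition col (t : nat) : nat := (pos t).2.
Definition height (t : nat) : int := (point t).2.

Definition is_lambda_path (la : seq nat) : Prop :=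
  [/\ forall t, t <= M -> young la (pos t),
      forall t, 1 <= t <= M -> odd t -> row t = row t.-1,
      forall t, 1 <= t <= M -> ~~ odd t -> col t = col t.-1
    & forall t, 1 <= t <= M ->
        (height t - height t.-1 = 1 \/ height t - height t.-1 = -1)%R].

(* The subpath from time a to time b is a height excursion. *)
Definition height_excursion (a b : nat) : Prop :=
  [/\ a < b <= M, height a = height b
    & forall t, a < t < b -> (height b < height t)%R].

Definition balanced (a b : nat) : Prop := pos a.+1 = pos b.

End Paths.

Definition is_dyck_path (k : nat) (h : nat -> int) : Prop :=
  [/\ h 0 = 0%R /\ h (2 * k) = 0%R,
      forall t, 1 <= t <= 2 * k ->
        (h t - h t.-1 = 1 \/ h t - h t.-1 = -1)%R
    & forall t, 1 <= t <= (2 * k).-1 -> (0 <= h t)%R].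

Definition is_lambda_dyck_path (la : seq nat) (k : nat) (pi : path3 (2 * k)) :
    Prop :=
  [/\ is_lambda_path pi la,
      is_dyck_path k (height pi),
      pos pi 0 = pos pi (2 * k)
    & ~ exists a b, height_excursion pi a b /\ ~ balanced pi a b].

Definition lambda_dyck_paths (la : seq nat) (k : nat) : set (path3 (2 * k)) :=
  [set pi | is_lambda_dyck_path la pi]%classic.

Arguments lambda_dyck_paths la k : clear implicits.

(* Main.v *)
Require Import Defs.
From mathcomp Require Import all_boot all_order all_algebra.
From mathcomp Require Import classical_sets functions.
From mathcomp Require Import zify.
Set Implicit Arguments.
Unset Strict Implicit.
Unset Printing Implicit Defensive.
Import Order.TTheory GRing.Theory Num.Theory.
(* [classical_sets] also exports a [point]. *)
Import Defs.

Local Open Scope nat_scope.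

(** Walk around the contour of the tree, recording at each step the labels of
    the edge just traversed, the endpoint of even depth first, together with the
    current depth; the initial position is that of the last step.  Balance says
    that the step down along an edge records the same labels as the step up, so
    a path is determined by its heights and by its positions after the up-steps,
    and the first-return decomposition of the height recovers the tree. *)

(** * Contours of labelled plane trees *)

(** Splitting off the leftmost subtree, rather than treating all children at once, matches the
    first-return decomposition of the height. *)
Lemma plane_tree_ind (P : labelled_plane_tree -> Prop) :
    (forall c, P (Node c [::])) ->
    (forall c c' Us Ts, P (Node c' Us) -> P (Node c Ts) ->
       P (Node c (Node c' Us :: Ts))) ->
  forall T, P T.
Proof.
move=> P0 PS; fix IH 1; case=> c; elim=> [|U Ts IHTs]; first exact: P0.
by case: U (IH U) => c' Us PU; apply: PS.
Qed.

(* [p] is the parity of the depth of the parent. *)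
Definition edge_pos (p : bool) (parent child : nat) : nat * nat :=
  if p then (child, parent) else (parent, child).

Definition coord (p : bool) (x : nat * nat) : nat := if p then x.2 else x.1.

Lemma coord_edge_pos p c c' : coord p (edge_pos p c c') = c.
Proof. by case: p. Qed.

Lemma coord_negb_edge_pos p c c' : coord (~~ p) (edge_pos p c c') = c'.
Proof. by case: p. Qed.

Lemma edge_pos_coord p x : edge_pos p (coord p x) (coord (~~ p) x) = x.
Proof. by case: p; case: x. Qed.

(** The starting point is left out, so that the contours of successive subtrees concatenate; [h] is
    the height of the root and [p] the parity of its depth. *)
Fixpoint contour (p : bool) (h : int) (T : labelled_plane_tree) :
    seq (nat * nat * int) :=
  let: Node c Ts := T in
  flatten (map (fun U =>
    (edge_pos p c (root_label U), h + 1)%R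
      :: contour (~~ p) (h + 1)%R U ++ [:: (edge_pos p c (root_label U), h)]) Ts).

Lemma contour_cons p h c c' Us Ts :
  contour p h (Node c (Node c' Us :: Ts)) =
  (edge_pos p c c', h + 1)%R :: contour (~~ p) (h + 1)%R (Node c' Us)
    ++ (edge_pos p c c', h) :: contour p h (Node c Ts).
Proof. by rewrite /= -catA. Qed.

Lemma edge_labels_cons c c' Us Ts :
  edge_labels (Node c (Node c' Us :: Ts)) =
  (c, c') :: edge_labels (Node c' Us) ++ edge_labels (Node c Ts).
Proof. by []. Qed.

Lemma vertex_labels_cons c c' Us Ts :
  vertex_labels (Node c (Node c' Us :: Ts)) =
  c :: vertex_labels (Node c' Us) ++ behead (vertex_labels (Node c Ts)).
Proof. by []. Qed.

Lemma size_contour p h T : size (contour p h T) = 2 * (num_vertices T).-1.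
Proof.
elim/plane_tree_ind: T p h => [//|c c' Us Ts IHU IHT] p h.
rewrite contour_cons /num_vertices vertex_labels_cons.
rewrite /= !size_cat /= IHU IHT /num_vertices /=; lia.
Qed.

Lemma contour_height_ge p h T : all (fun x => h <= x.2)%R (contour p h T).
Proof.
elim/plane_tree_ind: T p h => [//|c c' Us Ts IHU IHT] p h.
rewrite contour_cons /= all_cat /= IHT lexx lerDl ler01 !andbT /=.
by apply: sub_all (IHU (~~ p) (h + 1)%R) => x; apply: le_trans; rewrite lerDl.
Qed.

(** The walk ends by descending along the last edge at the root, so its last point carries the label
    of the root. *)
Lemma last_contour p h c Ts x : Ts <> [::] ->
  exists c', last x (contour p h (Node c Ts)) = (edge_pos p c c', h).
Proof.
elim: Ts x => [//|[c' Us] Ts IH] x _.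
rewrite contour_cons /= last_cat last_cons.
case: Ts IH => [|U Ts] IH; first by exists c'.
exact: IH.
Qed.

(** Both [x] and [y] are the first entries that fail [P], so they sit at the same place. This serves
    to locate the first return to a given height. *)
Lemma cat_sep_inj (A : Type) (P : pred A) (s1 s2 t1 t2 : seq A) x y :
    all P s1 -> all P t1 -> s1 ++ x :: s2 = t1 ++ y :: t2 ->
  ~~ P x -> ~~ P y -> s1 = t1 /\ s2 = t2.
Proof.
elim: s1 t1 => [|a s1 IH] [|b t1] //=.
- by move=> _ _ [].
- by move=> _ /andP[Pb _] [->]; rewrite Pb.
- by move=> /andP[Pa _] _ [<-] _ _; rewrite Pa.
move=> /andP[_ P1] /andP[_ P2] [-> e] Px Py.
by have [-> ->] := IH _ P1 P2 e Px Py.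
Qed.

(** The first point reveals the label of the first child, and the first return to height [h]
    separates the contour of its subtree from the rest. The root labels are compared separately
    because a single vertex has an empty contour. *)
Lemma contour_inj p h T T' :
  root_label T = root_label T' -> contour p h T = contour p h T' -> T = T'.
Proof.
elim/plane_tree_ind: T p h T' => [c|c c' Us Ts IHU IHT] p h [d [|[d' Vs] Ss]].
- by move=> /= ->.
- by rewrite contour_cons.
- by rewrite contour_cons.
move=> e; have {e} <- : c = d := e.
rewrite !contour_cons => -[ec].
have ed : d' = c'.
  by rewrite -(coord_negb_edge_pos p c d') -ec coord_negb_edge_pos.
subst d'.
have ht q T : all (fun x => h < x.2)%R (contour q (h + 1)%R T).
  by apply: sub_all (contour_height_ge q _ T) => x /=; lia.
move=> /(cat_sep_inj (ht (~~ p) (Node c' Us)) (ht (~~ p) (Node c' Vs))) eUT.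
have [||eU eT] := eUT; rewrite /= ?ltxx //.
have [->] := IHU _ _ (Node c' Vs) erefl eU.
by have [->] := IHT _ _ (Node c Ss) erefl eT.
Qed.

(** * Contours as stretches of a sequence of points indexed by time *)

Section Traces.
Variables (la : seq nat) (X : nat -> nat * nat * int).

Definition young_edge (e : nat * nat) : bool :=
  young la (e.1, e.2) && young la (e.2, e.1).

Lemma young_edge_pos p c c' : young_edge (c, c') -> young la (edge_pos p c c').
Proof. by case/andP; case: p. Qed.

(** The vertex visited at time [t.-1] has depth of parity [odd t.-1] and lies on both the edge just
    traversed and the next one. Preserving its coordinate expresses the conditions on odd and even
    steps at once. *)
Definition lambda_step (t : nat) : Prop :=
  [/\ young la (X t).1,
      coord (odd t.-1) (X t).1 = coord (odd t.-1) (X t.-1).1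
    & ((X t).2 - (X t.-1).2 = 1 \/ (X t).2 - (X t.-1).2 = -1)%R].

Definition excursion (a b : nat) : Prop :=
  [/\ a < b, (X a).2 = (X b).2
    & forall t, a < t < b -> ((X b).2 < (X t).2)%R].

(** From a tree to a path: an up-step at [a.+1], the contour of the first subtree, the matching
    down-step at [m], then the contour of the remaining tree. The final height and coordinate belong
    to the conclusion so that consecutive stretches can be glued. *)
Lemma contour_trace p h a b T :
    odd a = p -> (X a).2 = h -> coord p (X a).1 = root_label T ->
    all young_edge (edge_labels T) ->
    b = a + size (contour p h T) ->
    [seq X t | t <- iota a.+1 (size (contour p h T))] = contour p h T ->
  [/\ forall t, a < t <= b -> lambda_step t,
      forall t, a <= t <= b -> (h <= (X t).2)%R,
      (X b).2 = h,
      coord p (X b).1 = root_label T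
    & forall s t, a <= s -> t <= b -> excursion s t -> (X s.+1).1 = (X t).1].
Proof.
elim/plane_tree_ind: T p h a b => [c|c c' Us Ts IHU IHT] p h a b pa ha ca.
  move=> _ /=; rewrite addn0 => -> _; split=> //.
  - by move=> t; lia.
  - by move=> t ?; have -> : t = a by [lia]; rewrite ha.
  - by move=> s t ? ? [? _ _]; lia.
rewrite edge_labels_cons -cat1s !all_cat all_seq1 => /and3P[ecc eU eT].
rewrite contour_cons.
set sU := contour _ _ (Node c' Us); set sT := contour _ _ (Node c Ts).
rewrite /= size_cat /= => eb.
rewrite iotaD map_cat /= => -[X1 /eqP].
rewrite eqseq_cat ?size_map ?size_iota // => /andP[/eqP XU].
rewrite eqseq_cons => /andP[/eqP X2 /eqP XT].
(* A contour has even length, so [m], the time of the return to the root, has the parity of [a]. *)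
have sz : odd (size sU) = false by rewrite size_contour; lia.
set m := a.+2 + size sU in X2 XT.
have em : m = (a.+1 + size sU).+1 by rewrite /m; lia.
clearbody m.
have [] := IHU (~~ p) (h + 1)%R a.+1 (a.+1 + size sU) _ _ _ _ erefl XU => //=.
- by rewrite pa.
- by rewrite X1.
- by rewrite X1 coord_negb_edge_pos.
move=> sU1 hU1 lU cU bU.
have [] := IHT p h m b _ _ _ eT _ XT.
- by lia.
- by rewrite X2.
- by rewrite X2 coord_edge_pos.
- by rewrite -/sT; lia.
move=> sT1 hT1 lT cT bT; split=> //.
- move=> t tab.
  case: (ltngtP t a.+1) => [|ta|->]; first by lia.
    case: (ltngtP t m) => tm; [by apply: sU1; lia | by apply: sT1; lia |].
    rewrite tm; split; rewrite X2 /=.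
    + exact: young_edge_pos.
    + have -> : odd m.-1 = ~~ p by lia.
      by rewrite coord_negb_edge_pos em cU.
    + by rewrite em lU; right; lia.
  split; rewrite X1 /=.
  + exact: young_edge_pos.
  + by rewrite pa coord_edge_pos ca.
  + by rewrite ha; left; lia.
- move=> t tab; case: (ltngtP t a) => [|ta|->]; [by lia | | by rewrite ha].
  case: (ltnP t m) => tm; last by apply: hT1; lia.
  by have := hU1 t; lia.
move=> s t sa tb [st hst hin].
have Xm : (X m).2 = h by rewrite X2.
(* An excursion starting at or after [m] stays in the last stretch. One starting inside the first
   subtree has height at least [h + 1] at its ends, so it can neither end at [m] nor pass it. One
   starting at [a] must end at the first return [m], whose step records the same edge as the step at
   [a.+1]. *)
case: (leqP m s) => ms; first by apply: bT.
case: (ltngtP s a) => [|{}sa|{}sa]; first by lia.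
  have hs : (h + 1 <= (X s).2)%R by apply: hU1; lia.
  case: (ltngtP t m) => tm.
  - by apply: bU; [lia | lia | split].
  - by have := hin m; lia.
  - by move: hst; rewrite tm; lia.
have {}hst : (X t).2 = h by rewrite -hst sa.
case: (ltngtP t m) => tm.
- by have := hU1 t; lia.
- by have := hin m; lia.
by rewrite sa tm X1 X2.
Qed.

(** From a path to a tree: the first return [m] to the starting height cuts off the first subtree,
    traced from [a.+1] to [m.-1], and leaves the rest, traced from [m] to [b]. Balance makes the
    up-step and the down-step name the same edge, and self-conjugacy supplies the other order of its
    endpoints. *)
Lemma trace_contour a b :
    a <= b -> (forall t, a < t <= b -> lambda_step t) ->
    (forall t, a <= t <= b -> ((X a).2 <= (X t).2)%R) -> (X b).2 = (X a).2 ->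
    (forall s t, a <= s -> t <= b -> excursion s t -> (X s.+1).1 = (X t).1) ->
    self_conjugate la ->
  exists T,
    [/\ root_label T = coord (odd a) (X a).1, all young_edge (edge_labels T)
      & contour (odd a) (X a).2 T = [seq X t | t <- iota a.+1 (b - a)]].
Proof.
move=> ab steps ge ends bal sc.
have [n] := ubnP (b - a); elim: n a b ab steps ge ends bal => // n IH a b.
rewrite leq_eqVlt => /orP[/eqP <- *|ab steps ge ends bal lt_n].
  by exists (Node (coord (odd a) (X a).1) [::]); split=> //; rewrite subnn.
have h1 : (X a.+1).2 = ((X a).2 + 1)%R.
  have [_ _] := steps a.+1 ltac:(lia); have := ge a.+1; rewrite /=; lia.
have exm : exists m, (a < m) && ((X m).2 == (X a).2).
  by exists b; rewrite ab ends eqxx.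
case: (ex_minnP exm) => m /andP[am /eqP hm] minm.
have mb : m <= b by apply: minm; rewrite ab ends eqxx.
have gt t : a < t < m -> ((X a).2 + 1 <= (X t).2)%R.
  move=> tam; have := ge t; have := minm t.
  by case: eqP => ?; lia.
have am1 : a.+1 < m.
  by case: (ltngtP a.+1 m) => // [|em]; [lia | move: hm; rewrite -em h1; lia].
have Xm : (X a.+1).1 = (X m).1.
  by apply: bal => //; split=> // t tam; have := gt t; lia.
have hm1 : (X m.-1).2 = (X a.+1).2.
  have [_ _] := steps m ltac:(lia); have := gt m.-1; lia.
have [[c' Us] [rU eU sU]] : exists T,
    [/\ root_label T = coord (odd a.+1) (X a.+1).1, all young_edge (edge_labels T)
      & contour (odd a.+1) (X a.+1).2 T
        = [seq X t | t <- iota a.+2 (m.-1 - a.+1)]].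
  apply: IH => //; try lia.
  - by move=> t ?; apply: steps; lia.
  - by move=> t ?; rewrite h1; apply: gt; lia.
  - by move=> s t ? ?; apply: bal; lia.
(* The stretch from [a.+1] to [m.-1] is as long as a contour, hence even. *)
have par : odd m = odd a.
  have := congr1 size sU; rewrite size_map size_iota size_contour; lia.
have [[c Ts] [rT eT sT]] : exists T,
    [/\ root_label T = coord (odd m) (X m).1, all young_edge (edge_labels T)
      & contour (odd m) (X m).2 T = [seq X t | t <- iota m.+1 (b - m)]].
  apply: IH => //; try lia.
  - by move=> t ?; apply: steps; lia.
  - by move=> t ?; rewrite hm; apply: ge; lia.
  - by move=> s t ? ?; apply: bal; lia.
have [y1 c1 _] := steps a.+1 ltac:(lia).
(* The root labels of the two trees are read at times [a.+1] and [m]; by balance these are the two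
   coordinates of a single position. *)
have Xe : (X a.+1).1 = edge_pos (odd a) c c'.
  by move: rU rT => /= -> ->; rewrite par -Xm edge_pos_coord.
exists (Node c (Node c' Us :: Ts)); split.
- by move: rT => /= ->; rewrite par -Xm c1.
- rewrite edge_labels_cons -cat1s !all_cat all_seq1 eU eT !andbT /young_edge /=.
  by move: y1; rewrite Xe /edge_pos; case: (odd a) => /= y; rewrite y sc y.
have -> : b - a = (1 + (m.-1 - a.+1) + 1 + (b - m)) by lia.
rewrite contour_cons -h1 -[~~ odd a]/(odd a.+1) sU -par -hm sT par.
rewrite !iotaD !map_cat -catA /=.
have -> : a.+1 + (1 + (m.-1 - a.+1)) = m by lia.
have -> : a.+1 + (1 + (m.-1 - a.+1) + 1) = m.+1 by lia.
by rewrite addn1 -Xe -surjective_pairing Xm -surjective_pairing.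
Qed.

End Traces.

(** * Ranges of labels, and walks as tuples *)

Lemma young_edge_label la c c' : young_edge la (c, c') ->
  (1 <= c <= plength la) && (1 <= c' <= plength la).
Proof. by case/andP=> /andP[/= -> _] /andP[/= -> _]. Qed.

(** Every vertex other than the root is the child end of an edge, whose pair of labels lies in the
    diagram. *)
Lemma vertex_labels_in_range la T :
    1 <= root_label T <= plength la -> all (young_edge la) (edge_labels T) ->
  all (fun c => 1 <= c <= plength la) (vertex_labels T).
Proof.
elim/plane_tree_ind: T => [c /= -> //|c c' Us Ts IHU IHT /= cr].
rewrite all_cat => /and3P[/young_edge_label/andP[_ c'r] eU eT].
have {IHU} vU := IHU c'r eU; have /= {IHT}/andP[_ vT] := IHT cr eT.
by rewrite cr /= all_cat vT andbT; exact: vU.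
Qed.

(** Prepending the last point closes the path; the default value appears only for a single
    vertex. *)
Definition walk (T : labelled_plane_tree) : seq (nat * nat * int) :=
  let s := contour false 0 T in last (0, 0, 0%R) s :: s.

Lemma size_walk T : size (walk T) = (2 * (num_vertices T).-1).+1.
Proof. by rewrite /= size_contour. Qed.

(** The constant tuple is returned only when the walk does not have [M.+1] points, so never for a
    tree on [k.+1] vertices when [M = 2 * k]. *)
Definition walk_path (M : nat) (T : labelled_plane_tree) : path3 M :=
  insubd [tuple of nseq M.+1 (0, 0, 0%R)] (walk T).

Lemma val_walk_path M T : size (walk T) = M.+1 -> walk_path M T = walk T :> seq _.
Proof. by move=> sz; rewrite /walk_path insubdK // unfold_in sz. Qed.

Lemma lambda_pathP la M (pi : path3 M) :
  is_lambda_path pi la <->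
  young la (pos pi 0) /\ forall t, 0 < t <= M -> lambda_step la (point pi) t.
Proof.
split=> [[py pr pc ph]|[y0 st]].
  split=> [|t tM]; first exact: py.
  split; [by apply: py; lia | | exact: ph].
  case: t tM => //= t tM; case: (boolP (odd t)) => ot /=.
    by apply: (pc t.+1) => //=; rewrite ot.
  by apply: (pr t.+1).
split.
- by case=> [//|t] tM; have [] := st t.+1 tM.
- move=> [//|t] tM /= ot; have [_ + _] := st t.+1 tM.
  by rewrite /= (negbTE ot).
- move=> [//|t] tM /=; rewrite negbK => ot; have [_ + _] := st t.+1 tM.
  by rewrite /= ot.
- by move=> t tM; have [] := st t tM.
Qed.

Lemma map_point M (pi : path3 M) : pi = map (point pi) (iota 0 M.+1) :> seq _.
Proof. by rewrite -[in iota _ _](size_tuple pi) -/(mkseq _ _) mkseq_nth. Qed.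

Theorem theorem4p6 (la : seq nat) (k : nat)
    (la_partition : is_partition la) (la_selfconj : self_conjugate la)
    (k_pos : 1 <= k) :
  exists f : labelled_plane_tree -> path3 (2 * k),
    set_bij (lambda_plane_trees la k.+1) (lambda_dyck_paths la k) f.
Proof.
have sz T : num_vertices T = k.+1 -> size (contour false 0 T) = 2 * k.
  by rewrite size_contour => ->.
have wpE T : num_vertices T = k.+1 -> walk_path (2 * k) T = walk T :> seq _.
  by move=> nT; apply: val_walk_path; rewrite size_walk nT.
(* Here [1 <= k] excludes the single vertex, whose contour is empty. *)
have lastE T x : num_vertices T = k.+1 ->
    exists c', last x (contour false 0 T) = (edge_pos false (root_label T) c', 0%R).
  case: T => c [|U Ts] nT; last exact: last_contour.
  by move: (sz _ nT) => /=; lia.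
exists (walk_path (2 * k)); split.
(* The walk of a tree is a path of the required kind: its initial point has the root label as row
   and height 0, so [contour_trace] applies from time 0. *)
- move=> T [/andP[vT eT] nT]; have wT := wpE T nT; have sT := sz T nT.
  set pi := walk_path _ _ in wT *.
  have [c' lT] := lastE T (0, 0, 0%R) nT.
  have X0 : point pi 0 = (edge_pos false (root_label T) c', 0%R).
    by rewrite /point wT.
  have Xlast : point pi (2 * k) = point pi 0.
    rewrite /point wT -sT -[size _]/(size (walk T)).-1 nth_last /walk /=.
    by case: (contour _ _ _).
  have Xs : [seq point pi t | t <- iota 1 (size (contour false 0 T))]
      = contour false 0 T.
    by have := map_point pi; rewrite wT sT => -[_ <-].
  have [] := @contour_trace la (point pi) false 0%R 0 (2 * k) T _ _ _ eT _ Xs.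
  + by [].
  + by rewrite X0.
  + by rewrite X0.
  + by rewrite sT.
  move=> st ge _ _ bal; split.
  + apply/lambda_pathP; split=> //; rewrite /pos -Xlast.
    by have [] := st (2 * k) ltac:(lia).
  + split.
    * by rewrite /height Xlast X0.
    * by move=> t tk; have [_ _ ] := st t tk.
    * by move=> t tk; apply: ge; lia.
  + by rewrite /pos Xlast.
  + move=> [a [b [[/andP[ab bk] hab hin]]]]; apply.
    by apply: bal => //; split.
(* Injectivity: equal walks have equal contours as tails, and the common last point gives equal root
   labels. *)
- move=> T T' /set_mem[_ nT] /set_mem[_ nT'] /(congr1 val) /=.
  rewrite !wpE // => -[_ eTT'].
  apply: (contour_inj _ eTT').
  have [c' lT] := lastE T (0, 0, 0%R) nT.
  have [d' lT'] := lastE T' (0, 0, 0%R) nT'.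
  by move: lT; rewrite eTT' lT' => -[].
(* Surjectivity: [trace_contour] on the whole time interval yields the preimage. *)
move=> pi [/lambda_pathP[y0 st] [[h0 hk] _ ge] closed bal].
have [|||||//|T [rT eT sT]] := @trace_contour la (point pi) 0 (2 * k).
- by [].
- by [].
(* The Dyck condition bounds the height only strictly between the two ends, where it is 0. *)
- move=> t tk; rewrite [(point pi 0).2]h0.
  case: (ltngtP t 0) => [//|t0|->]; last by rewrite [(point pi 0).2]h0.
  case: (ltngtP t (2 * k)) => [tk'||->]; [by apply: ge; lia | by lia |].
  by rewrite [(point pi _).2]hk.
- by rewrite [LHS]hk [RHS]h0.
- move=> a b _ bk [ab hab hin].
  case: (pos pi a.+1 =P pos pi b) => // unb; case: bal.
  by exists a, b; split=> //; split=> //; rewrite ab.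
have {}sT : contour false 0 T = [seq point pi t | t <- iota 1 (2 * k)].
  by rewrite -[0%R]h0 sT subn0.
(* Comparing sizes determines only [(num_vertices T).-1]; exposing the root shows that the number of
   vertices is positive. *)
have nT : num_vertices T = k.+1.
  have := congr1 size sT; rewrite size_contour size_map size_iota.
  by case: (T) => c Ts; rewrite /num_vertices /=; lia.
exists T; first split=> //.
  rewrite /is_lambda_plane_tree [X in _ && X]eT andbT.
  by apply: vertex_labels_in_range => //; rewrite rT; case/andP: y0.
(* Only the initial points remain to be compared: the walk starts with a copy of its last point, and
   [pi] has equal positions and equal heights at both ends. *)
apply: val_inj; rewrite /= wpE // [RHS]map_point /walk sT /=; congr cons.
have -> : iota 1 (2 * k) = rcons (iota 1 (2 * k).-1) (2 * k).
  have [n ->] : exists n, 2 * k = n.+1 by exists (2 * k).-1; lia.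
  by rewrite -[X in iota 1 X = _]addn1 iotaD cats1 add1n.
rewrite map_rcons last_rcons.
rewrite [LHS]surjective_pairing [RHS]surjective_pairing.
by congr pair; [rewrite -[LHS]closed | rewrite [LHS]hk [RHS]h0].
Qed.
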